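(* Let $\alpha>0$ and, for a unit quaternion $q_e=[q_{ev}^\top,q_{e4}]^\top$ with $q_{e4}\ne0$, let $V_q=-\alpha\ln q_{e4}^2$. Given any scalar $\delta\in(0,1)$, there exist two positive constants $\overline{\alpha}$ and $\underline{\alpha}$ satisfying $\overline\alpha\ge-\alpha\ln\delta^2/(1-\delta^2)$ and $\underline\alpha\le1$ such that the following inequality holds for all unit quaternions $q_e$ with $\delta\le|q_{e4}|\le1$: $$\underline\alpha\|q_{ev}\|^2\le V_q\le\overline\alpha\|q_{ev}\|^2.$$
   Context: A unit quaternion is $q_e=[q_{ev}^\top,q_{e4}]^\top\in\mathbb{R}^3\times\mathbb{R}$ with $q_{ev}^\top q_{ev}+q_{e4}^2=1$; $\|\cdot\|$ is the Euclidean norm. *)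

(* Defs.v *)
From mathcomp Require Import all_boot all_order all_algebra.
From mathcomp Require Import all_classical all_reals all_analysis.
Set Implicit Arguments.
Unset Strict Implicit.
Unset Printing Implicit Defensive.
Import Order.TTheory GRing.Theory Num.Theory.
Local Open Scope ring_scope.

(* A pair (q.1, q.2) stands for the column [q_v^T, q_4]^T, with vector part
   q.1 and scalar part q.2. *)
Definition unit_quaternion (R : realType) (q : 'cV[R]_3 * R) : Prop :=
  (q.1^T *m q.1) 0 0 + q.2 ^+ 2 = 1.

(* The norm `|v| that MathComp-Analysis puts on matrices is the sup norm. *)
Definition euclidean_norm (R : realType) (n : nat) (v : 'cV[R]_n) : R :=
  Num.sqrt ((v^T *m v) 0 0).

(* Only meaningful for q.2 != 0; ln is total, with ln x = 0 for x <= 0. *)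
Definition Vq (R : realType) (alpha : R) (q : 'cV[R]_3 * R) : R :=
  - alpha * ln (q.2 ^+ 2).

(* Main.v *)
(* Everything reduces to 1 - x <= - ln x <= (1 - x) / c for c <= x (with the
   right half for x <= 1), which is ln t <= t - 1 at t = x and at t = 1 / x,
   with x = q_4 ^ 2, c = delta ^ 2 and |q_v| ^ 2 = 1 - x. So alpha_under =
   min(1, alpha) and alpha_over = alpha / delta ^ 2 work; the upper bound at
   x = delta ^ 2 itself gives the required lower bound on alpha_over. *)
Require Import Defs.
From mathcomp Require Import all_boot all_order all_algebra.
From mathcomp Require Import all_classical all_reals all_analysis.
Set Implicit Arguments.
Unset Strict Implicit.
Unset Printing Implicit Defensive.
Import Order.TTheory GRing.Theory Num.Theory.
Local Open Scope ring_scope.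

Lemma ln_le_subr1 (R : realType) (x : R) : 0 < x -> ln x <= x - 1.
Proof.
move=> x0; have := @le_ln1Dx R (x - 1).
by rewrite (addrC 1) subrK ltrDr; apply.
Qed.

Lemma oppr_ln_ge (R : realType) (x : R) : 0 < x -> 1 - x <= - ln x.
Proof. by move=> x0; rewrite lerNr opprB ln_le_subr1. Qed.

Lemma oppr_ln_le (R : realType) (c x : R) :
  0 < c -> c <= x -> x <= 1 -> - ln x <= (1 - x) / c.
Proof.
move=> c0 cx x1; have x0 := lt_le_trans c0 cx.
rewrite -lnV ?posrE//.
(* The middle term is [x^-1 - 1], the tangent bound at [x^-1]; lowering the denominator to [c] needs
   [0 <= 1 - x]. *)
apply: (@le_trans _ _ ((1 - x) / x)).
  by rewrite mulrBl mul1r divff ?gt_eqF// ln_le_subr1 ?invr_gt0.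
by rewrite ler_wpM2l ?subr_ge0// lef_pV2 ?posrE.
Qed.

(** The radicand is a sum of squares, so the square root is not truncated to 0. *)
Lemma euclidean_norm_sqr (R : realType) (n : nat) (v : 'cV[R]_n) :
  euclidean_norm v ^+ 2 = (v^T *m v) 0 0.
Proof.
rewrite sqr_sqrtr// mxE sumr_ge0// => i _.
by rewrite mxE -expr2 sqr_ge0.
Qed.

Theorem lemma2 (R : realType) (alpha : R) (halpha : 0 < alpha)
    (delta : R) (hdelta0 : 0 < delta) (hdelta1 : delta < 1) :
  exists alpha_over alpha_under : R,
    [/\ 0 < alpha_over,
        0 < alpha_under,
        alpha_over >= - alpha * ln (delta ^+ 2) / (1 - delta ^+ 2),
        alpha_under <= 1
      & forall q : 'cV[R]_3 * R,
          unit_quaternion q ->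
          delta <= `|q.2| -> `|q.2| <= 1 ->
          alpha_under * euclidean_norm q.1 ^+ 2 <= Vq alpha q /\
          Vq alpha q <= alpha_over * euclidean_norm q.1 ^+ 2].
Proof.
have d2_gt0 : 0 < delta ^+ 2 by rewrite exprn_gt0.
have d2_lt1 : delta ^+ 2 < 1 by rewrite expr_lt1// ltW.
exists (alpha / delta ^+ 2), (Num.min 1 alpha); split.
- by rewrite divr_gt0.
- by rewrite lt_min ltr01.
(* Clearing [1 - delta ^+ 2] and cancelling [alpha] leaves [oppr_ln_le] with
   [c = x = delta ^+ 2]. *)
- rewrite ler_pdivrMr ?subr_gt0// mulNr -mulrN -mulrA ler_pM2l//.
  by rewrite mulrC oppr_ln_le// ltW.
- by rewrite ge_min lexx.
move=> q q_unit dq q1; rewrite euclidean_norm_sqr /Vq.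
have d2q : delta ^+ 2 <= q.2 ^+ 2.
  by rewrite -(real_normK (num_real q.2)) ler_pXn2r ?nnegrE// ltW.
have q2_le1 : q.2 ^+ 2 <= 1.
  by rewrite -(real_normK (num_real q.2)) expr_le1.
have -> : (q.1^T *m q.1) 0 0 = 1 - q.2 ^+ 2 by rewrite -q_unit addrK.
rewrite mulNr -mulrN; split.
  (* The minimum is at most [alpha], and its factor [1 - q.2 ^+ 2] is nonnegative, so the bound with
     [alpha] itself suffices. *)
  apply: (@le_trans _ _ (alpha * (1 - q.2 ^+ 2))).
    by rewrite ler_wpM2r ?subr_ge0// ge_min lexx orbT.
  by rewrite ler_pM2l// oppr_ln_ge// (lt_le_trans d2_gt0).
by rewrite -mulrA ler_pM2l// mulrC oppr_ln_le.
Qed.
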